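(* Let $H$ be a probability measure on $\mathbb{R}$ with its Borel $\sigma$-algebra and let $c>0$ be a fixed number. For each integer $n\ge1$ let $P_{H,n^2c}\sim\text{N-IGP}(n^2c,H)$ (i.e. the concentration parameter is $a=n^2c$), all defined on a common probability space. Then, as $n\to\infty$, $$\sup_{x\in\mathbb{R}}\left|P_{H,n^2c}(x)-H(x)\right|\overset{a.s.}{\to}0.$$
   Context: Normalized inverse-Gaussian distribution: for $m\ge 2$ and $\gamma_1,\dots,\gamma_m>0$, a random vector $(Z_1,\dots,Z_m)$ with values in $\mathbb{S}=\{(z_1,\dots,z_m): z_i\ge 0,\ \sum_{i=1}^m z_i=1\}$ has the normalized inverse-Gaussian distribution $\text{N-IG}(\gamma_1,\dots,\gamma_m)$ if it has density (with respect to Lebesgue measure in $(z_1,\dots,z_{m-1})$, with $z_m=1-\sum_{i<m}z_i$) $$f(z_1,\dots,z_m)=\frac{e^{\sum_{i=1}^m\gamma_i}\prod_{i=1}^m\gamma_i}{2^{m/2-1}\pi^{m/2}}\,K_{-m/2}\!\left(\sqrt{\sum_{i=1}^m\frac{\gamma_i^2}{z_i}}\right)\left(\sum_{i=1}^m\frac{\gamma_i^2}{z_i}\right)^{-m/4}\prod_{i=1}^m z_i^{-3/2}\, I_{\mathbb{S}}(z_1,\dots,z_m),$$ where $K_\nu$ is the modified Bessel function of the third type (also called of the second kind, or Macdonald function). Normalized inverse-Gaussian process: for a probability measure $H$ on a measurable space $(\mathfrak{X},\mathcal{A})$ and $a>0$, a random probability measure $P_{H,a}$ on $(\mathfrak{X},\mathcal{A})$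 is a normalized inverse-Gaussian process with parameters $a$ and $H$, written $P_{H,a}\sim\text{N-IGP}(a,H)$, if for every finite measurable partition $A_1,\dots,A_m$ of $\mathfrak{X}$ the vector $(P_{H,a}(A_1),\dots,P_{H,a}(A_m))$ has the $\text{N-IG}(aH(A_1),\dots,aH(A_m))$ distribution, with the convention that $P_{H,a}(A_i)=0$ almost surely whenever $H(A_i)=0$. For a (random) probability measure $\mu$ on $\mathbb{R}$, write $\mu(x)=\mu((-\infty,x])$. *)

(* Defs.v *)
From HB Require Import structures.
From mathcomp Require Import all_boot all_order all_algebra.
From mathcomp Require Import all_classical all_reals all_analysis.

Set Implicit Arguments.
Unset Strict Implicit.
Unset Printing Implicit Defensive.

Import Order.TTheory GRing.Theory Num.Theory.
Import numFieldNormedType.Exports.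

Local Open Scope classical_set_scope.
Local Open Scope ring_scope.

Section lebesgue_measure_on_tuples.
Context {R : realType}.
Notation RR := (measurableTypeR R).

Definition tcons n (p : RR * n.-tuple RR) : n.+1.-tuple RR :=
  [the n.+1.-tuple RR of p.1 :: p.2].

Lemma measurable_tcons n : measurable_fun [set: RR * n.-tuple RR] (@tcons n).
Proof. exact: measurable_cons. Qed.

Definition lebesgue_tcons n (mu : {sigma_finite_measure set (n.-tuple RR) -> \bar R})
    : set (n.+1.-tuple RR) -> \bar R :=
  pushforward (@lebesgue_measure R \x mu)%E (@tcons n).

Section lebesgue_tcons.
Context n (mu : {sigma_finite_measure set (n.-tuple RR) -> \bar R}).

Let lebesgue_tcons0 : lebesgue_tcons mu set0 = 0%E.
Proof. by rewrite /lebesgue_tcons /pushforward preimage_set0 measure0. Qed.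

Let lebesgue_tcons_ge0 A : (0 <= lebesgue_tcons mu A)%E.
Proof. by rewrite /lebesgue_tcons /pushforward measure_ge0. Qed.

Let lebesgue_tcons_sigma_additive : semi_sigma_additive (lebesgue_tcons mu).
Proof.
move=> F mF tF mUF; rewrite /lebesgue_tcons /pushforward preimage_bigcup.
apply: measure_semi_sigma_additive.
- by move=> n'; rewrite -[X in measurable X]setTI; exact: measurable_tcons.
- apply/trivIsetP => /= i j _ _ ij; rewrite -preimage_setI.
  by move/trivIsetP : tF => /(_ _ _ _ _ ij) ->//; rewrite preimage_set0.
- rewrite -preimage_bigcup -[X in measurable X]setTI.
  exact: measurable_tcons.
Qed.

HB.instance Definition _ := isMeasure.Build _ _ _ (lebesgue_tcons mu)
  lebesgue_tcons0 lebesgue_tcons_ge0 lebesgue_tcons_sigma_additive.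

Let lebesgue_tcons_sigma_finite : sigma_finite setT (lebesgue_tcons mu).
Proof.
have /sigma_finiteP[F [FT ndF Foo]] := sigma_finiteT (@lebesgue_measure R).
have /sigma_finiteP[G [GT ndG Goo]] := sigma_finiteT mu.
pose uncons (t : n.+1.-tuple RR) : RR * n.-tuple RR :=
  (thead t, [tuple of behead t]).
have unconsK p : uncons (tcons p) = p.
  case: p => x t; congr (_, _) => /=.
  exact/val_inj.
have muncons : measurable_fun setT uncons.
  apply/measurable_fun_pairP; split.
    exact: (@measurable_tnth _ RR n.+1 ord0).
  exact: measurable_behead.
exists (fun i => uncons @^-1` (F i `*` G i)).
  apply/esym; rewrite -subTset => t _.
  have [i _ Fi] : (\bigcup_i F i) (uncons t).1 by rewrite -FT.
  have [j _ Gj] : (\bigcup_i G i) (uncons t).2 by rewrite -GT.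
  exists (maxn i j) => //; split.
    by move: Fi; apply/subsetPset/ndF/leq_maxl.
  by move: Gj; apply/subsetPset/ndG/leq_maxr.
move=> i; have [mF ltF] := Foo i; have [mG ltG] := Goo i; split.
  by rewrite -[X in measurable X]setTI; apply: muncons => //; exact: measurableX.
rewrite /lebesgue_tcons /pushforward -comp_preimage.
rewrite (_ : uncons \o _ = id); last by apply/funext => p; exact: unconsK.
rewrite preimage_id product_measure1E//.
by rewrite lte_mul_pinfty// ge0_fin_numE.
Qed.

HB.instance Definition _ := Measure_isSigmaFinite.Build _ _ _
  (lebesgue_tcons mu) lebesgue_tcons_sigma_finite.

End lebesgue_tcons.

(* Lebesgue measure on R^n, identified with n.-tuple R. *)
Fixpoint lebesgue_tuple n : {sigma_finite_measure set (n.-tuple RR) -> \bar R} :=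
  match n with
  | 0%N => \d_([tuple] : 0.-tuple RR)
  | n'.+1 => lebesgue_tcons (lebesgue_tuple n')
  end.

End lebesgue_measure_on_tuples.

Section normalized_inverse_gaussian.
Context {R : realType}.

(* K_nu(x) for x > 0, by its integral representation, which becomes
   the integral of exp(- x cosh u) cosh(nu u) over u > 0 after t = exp u. *)
Definition besselK (nu x : R) : R :=
  2^-1 * \int[@lebesgue_measure R]_(t in `]0%R, +oo[)
           (t `^ (nu - 1) * expR (- (x / 2) * (t + t^-1))).

Definition std_simplex m : set ('I_m -> R) :=
  [set z | (forall i, 0 <= z i) /\ \sum_(i < m) z i = 1].

Definition NIG_density m (gamma z : 'I_m -> R) : R :=
  let A := \sum_(i < m) gamma i ^+ 2 / z i in
  expR (\sum_(i < m) gamma i) * (\prod_(i < m) gamma i)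
    / (2 `^ (m%:R / 2 - 1) * pi `^ (m%:R / 2))
  * besselK (- (m%:R / 2)) (Num.sqrt A)
  * A `^ (- (m%:R / 4))
  * (\prod_(i < m) z i `^ (- (3 / 2)))
  * \1_(@std_simplex m) z.

(* (t_1, ..., t_k) |-> (t_1, ..., t_k, 1 - sum_i t_i) *)
Definition simplex_point k (t : k.-tuple R) : 'I_k.+1 -> R :=
  fun i => if unlift ord_max i is Some j then tnth t j
           else 1 - \sum_(j < k) tnth t j.

Definition has_NIG_law d (Omega : measurableType d) (Pr : probability Omega R)
    k (gamma : 'I_k.+1 -> R) (Z : 'I_k.+1 -> Omega -> measurableTypeR R) : Prop :=
  [/\ (0 < k)%N,
      forall i, 0 < gamma i,
      forall i, measurable_fun setT (Z i),
      {ae Pr, forall w, std_simplex (Z ^~ w)} &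
      forall B : set (k.-tuple (measurableTypeR R)), measurable B ->
        Pr [set w | B [tuple Z (lift ord_max j) w | j < k]] =
        (\int[lebesgue_tuple k]_(t in B)
           (NIG_density gamma (simplex_point t))%:E)%E ].

(* A random probability measure on T is a probability kernel from Omega to T.
   The cells of a partition which are null for H are almost surely null for P;
   the remaining ones, listed in order by s, carry the N-IG law. When there is
   only one such cell the N-IG law is not defined, and P gives it mass 1 almost
   surely by the first clause. *)
Definition is_NIGP d (Omega : measurableType d) (Pr : probability Omega R)
    dT (T : measurableType dT) (a : R) (H : probability T R)
    (P : R.-pker Omega ~> T) : Prop :=
  0 < a /\
  forall (m : nat) (A : 'I_m -> set T),
    (forall i, measurable (A i)) -> trivIset setT A ->
    \bigcup_i A i = setT ->
    (forall i, H (A i) = 0%E -> {ae Pr, forall w, P w (A i) = 0%E}) /\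
    (forall k (s : 'I_k.+1 -> 'I_m), (0 < k)%N ->
      {homo s : i j / (i < j)%N} ->
      (forall i, (0 < H (A i))%E <-> exists j, s j = i) ->
      has_NIG_law Pr (fun j => a * fine (H (A (s j))))
                     (fun j w => fine (P w (A (s j))))).

End normalized_inverse_gaussian.

(* Main.v *)
Require Import Defs.
From HB Require Import structures.
From mathcomp Require Import all_boot all_order all_algebra.
From mathcomp Require Import all_classical all_reals all_analysis.
From mathcomp Require Import measurable_realfun ring lra.
Import Order.TTheory GRing.Theory Num.Theory.
Import numFieldNormedType.Exports.
Local Open Scope classical_set_scope.
Local Open Scope ring_scope.

(* For a two-cell partition with H-masses p and 1 - p, the argument of the
   Bessel function in the N-IG density is the square root of
   S = a^2 (1 + (z - p)^2 / (z (1 - z))).  Away from z = p it exceeds a by a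
   definite factor, so the exponential decay of K_1 beats the normalising
   factor e^a and the density is at most 2 / (eps^7 a) on |z - p| >= eps.  With
   a = n^2 c these tails are summable, and Borel-Cantelli gives
   P_n(A) -> H(A) almost surely for every Borel set A.  Applying this to the
   countably many half-lines ending at quantiles of H of rational order,
   monotonicity yields uniform convergence, as for Glivenko-Cantelli. *)

(* No measurability is assumed: the integral of a nonnegative function is a
   supremum over the simple functions below it. *)
Lemma ge0_le_integral_nonmeasurable d (T : measurableType d) (R : realType)
    (mu : {measure set T -> \bar R}) (D D' : set T) (f g : T -> \bar R) :
  (forall x, 0 <= f x)%E -> (forall x, 0 <= g x)%E ->
  (forall x, D x -> D' x /\ f x <= g x)%E ->
  (\int[mu]_(x in D) f x <= \int[mu]_(x in D') g x)%E.
Proof.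
move=> f0 g0 fg; rewrite (integral_mkcond D) (integral_mkcond D').
rewrite !ge0_integralTE; try by move=> x; rewrite patchE; case: ifP.
apply: ereal_sup_le => _ [h hf <-]; exists h => // x.
apply: le_trans (hf x) _; rewrite !patchE; case: ifPn => [|_].
  by rewrite inE => /fg[D'x fgx]; rewrite mem_set.
by case: ifP.
Qed.

(** * Exponential decay of the Bessel function of order -1 *)

Section besselK.
Variable R : realType.

Lemma expR_ge_half_sqr (y : R) : 0 <= y -> y ^+ 2 / 2 <= expR y.
Proof.
move=> y0; have := expR_ge1Dxn 1 y0; rewrite (_ : (2`!)%:R = 2%:R :> R)//.
lra.
Qed.

(* The fraction [eta] of the exponent pays for the integrability in [t]. *)
Lemma besselK_integrand_le (eta x t : R) : 0 < eta < 1 -> 0 < x -> 0 < t ->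
  t `^ (- (2%:R / 2) - 1) * expR (- (x / 2) * (t + t^-1)) <=
  8 / (eta * x) ^+ 2 * expR (- ((1 - eta) * x)) * (oneDsqr t)^-1.
Proof.
move=> /andP[eta0 eta1] x0 t0.
rewrite (_ : - (2%:R / 2) - 1 = - 2%:R); last by field.
rewrite powR_invn ?(ltW t0)//.
have t1 : 2 <= t + t^-1.
  have -> : t + t^-1 = 2 + (t - 1) ^+ 2 / t by field; lra.
  by rewrite lerDl divr_ge0 ?sqr_ge0// ltW.
have -> : - (x / 2) * (t + t^-1) =
    - ((1 - eta) * (x / 2) * (t + t^-1)) - eta * x / 2 * (t + t^-1) by ring.
rewrite expRD.
have e1 : expR (- ((1 - eta) * (x / 2) * (t + t^-1))) <=
    expR (- ((1 - eta) * x)).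
  rewrite ler_expR lerN2 -(mulrA (1 - eta)) ler_pM2l ?subr_gt0//.
  by rewrite -[leLHS](@divfK _ 2) ?pnatr_eq0// ler_wpM2l// divr_ge0// ltW.
(* As [t + t^-1 = (1 + t ^+ 2) / t], the bound [2 / y ^+ 2] on [expR (- y)] carries a factor
   [t ^+ 2] that cancels the singular [t ^- 2]. *)
set y := eta * x / 2 * (t + t^-1).
have y0 : 0 < y by rewrite mulr_gt0 ?divr_gt0 ?mulr_gt0 ?addr_gt0 ?invr_gt0.
have e2 : expR (- y) <= 2 / y ^+ 2.
  rewrite expRN -invf_div lef_pV2 ?posrE ?expR_gt0 ?divr_gt0 ?exprn_gt0//.
  exact/expR_ge_half_sqr/ltW.
have t20 : 0 < 1 + t ^+ 2 by rewrite ltr_wpDr ?sqr_ge0.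
apply: (@le_trans _ _ (t ^- 2 * (expR (- ((1 - eta) * x)) * (2 / y ^+ 2)))).
  rewrite ler_wpM2l ?invr_ge0 ?exprn_ge0 ?(ltW t0)//.
  by rewrite ler_pM ?expR_ge0.
have -> : t ^- 2 * (expR (- ((1 - eta) * x)) * (2 / y ^+ 2)) =
   8 / (eta * x) ^+ 2 * expR (- ((1 - eta) * x)) * (1 + t ^+ 2)^-2.
  rewrite /y; field.
  by repeat (apply/andP; split); lra || nra.
rewrite ler_wpM2l//.
  by rewrite mulr_ge0 ?expR_ge0// divr_ge0// exprn_ge0// mulr_ge0// ltW.
rewrite /oneDsqr lef_pV2 ?posrE ?exprn_gt0// ler_eXnr//.
by rewrite lerDl sqr_ge0.
Qed.

(** The pointwise bound is integrated using that [1 / (1 + t ^+ 2)] has integral [pi / 2] over the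
    half-line; the constant is [2^-1 * 8 * (pi / 2)]. The order [- (2%:R / 2)] is the one occurring
    for two cells. *)
Lemma besselK_le (eta x : R) : 0 < eta < 1 -> 0 < x ->
  besselK (- (2%:R / 2)) x <=
  2 * pi / (eta * x) ^+ 2 * expR (- ((1 - eta) * x)).
Proof.
move=> eta01 x0; set c := 8 / (eta * x) ^+ 2 * expR (- ((1 - eta) * x)).
have c0 : 0 <= c.
  by rewrite /c mulr_ge0 ?expR_ge0// divr_ge0// sqr_ge0.
suff int_le : (\int[@lebesgue_measure R]_(t in `]0%R, +oo[)
      (t `^ (- (2%:R / 2) - 1) * expR (- (x / 2) * (t + t^-1)))%:E <=
    (c * (pi / 2))%:E)%E.
  rewrite /besselK /Rintegral.
  rewrite (_ : _ * expR _ = 2^-1 * (c * (pi / 2))); last first.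
    by rewrite /c; field; rewrite !lt0r_neq0//; case/andP: eta01.
  rewrite ler_wpM2l// -lee_fin fineK// ge0_fin_numE.
    by rewrite (le_lt_trans int_le)// ltry.
  by apply: integral_ge0 => t _; rewrite lee_fin mulr_ge0 ?powR_ge0 ?expR_ge0.
rewrite EFinM -integral0y_oneDsqr -ge0_integralZl//; last first.
  apply/measurable_EFinP; apply: measurable_funTS.
  by apply: continuous_measurable_fun; exact: continuous_oneDsqrV.
apply: ge0_le_integral_nonmeasurable => t.
- by rewrite lee_fin mulr_ge0 ?powR_ge0 ?expR_ge0.
- by rewrite -EFinM lee_fin mulr_ge0// invr_ge0 (le_trans ler01).
- rewrite /= !in_itv/= !andbT => t0; split; first exact: ltW.
  by rewrite -EFinM lee_fin; exact: besselK_integrand_le.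
Qed.

End besselK.

(** * Pointwise bound on the two-cell density away from the mean *)

Section density.
Variable R : realType.

(* The Bessel bound is taken at [eta = eps^2], small enough that
   [(1 - eta) * x >= a] whenever [eps <= `|z - p|]. *)
Lemma NIG2_density_core_le (a p eps z : R) : 0 < a -> 0 < p < 1 ->
  0 < eps <= 1 / 2 -> eps <= `|z - p| -> 0 < z < 1 ->
  let x := Num.sqrt ((a * p) ^+ 2 / z + (a * (1 - p)) ^+ 2 / (1 - z)) in
  expR a * (a * p * (a * (1 - p))) *
    (2 * pi / (eps ^+ 2 * x) ^+ 2 * expR (- ((1 - eps ^+ 2) * x))) *
    x^-1 * (z * (1 - z)) `^ (- (3 / 2)) <= 2 * pi / (eps ^+ 7 * a).
Proof.
move=> a0 /andP[p0 p1] /andP[e0 e2] ez /andP[z0 z1].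
set S := (X in Num.sqrt X); cbv zeta; set x := Num.sqrt S.
have y0 : 0 < z * (1 - z) by rewrite mulr_gt0 ?subr_gt0.
have SE : S * (z * (1 - z)) = a ^+ 2 * (z * (1 - z) + (z - p) ^+ 2).
  by rewrite /S; field; rewrite !lt0r_neq0 ?subr_gt0.
have ez2 : eps ^+ 2 <= (z - p) ^+ 2.
  by rewrite -(real_normK (num_real (z - p))) lerXn2r ?nnegrE// ltW.
have y4 : z * (1 - z) <= 1 / 4 by have := sqr_ge0 (z - 1 / 2); nra.
have a20 : 0 < a ^+ 2 by rewrite exprn_gt0.
have e20 : 0 < eps ^+ 2 by rewrite exprn_gt0.
have S0 : 0 < S by rewrite -(pmulr_lgt0 _ y0) SE mulr_gt0// ltr_wpDr ?sqr_ge0.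
(* Since [z * (1 - z) <= 1 / 4], the excess [(z - p) ^+ 2 / (z * (1 - z))] is at least
   [4 * eps ^+ 2]. *)
have Sge : a ^+ 2 * (1 + 4 * eps ^+ 2) <= S.
  rewrite -(ler_pM2r y0) SE -mulrA ler_wpM2l ?(ltW a20)//; nra.
have x0 : 0 < x by rewrite sqrtr_gt0.
have xS : x ^+ 2 = S by rewrite sqr_sqrtr// ltW.
have ax : a <= (1 - eps ^+ 2) * x.
  rewrite -(@ler_pXn2r _ 2)// ?nnegrE ?(ltW a0)//; last first.
    by rewrite mulr_ge0 ?(ltW x0)//; nra.
  (* With [E = eps ^+ 2 <= 1 / 4], the squared claim reduces to [1 <= (1 - E) ^+ 2 * (1 + 4 * E)],
     that is, [0 <= 2 * E - 7 * E ^+ 2 + 4 * E ^+ 3]. *)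
  rewrite exprMn xS; apply: le_trans (_ : (1 - eps ^+ 2) ^+ 2 *
    (a ^+ 2 * (1 + 4 * eps ^+ 2)) <= _); last by rewrite ler_wpM2l// sqr_ge0.
  rewrite mulrCA -[leLHS]mulr1 ler_wpM2l ?(ltW a20)//.
  have e4 : eps ^+ 2 <= 1 / 4 by nra.
  set E := eps ^+ 2 in e20 e4 *; have : 0 <= E * (1 / 4 - E) by nra.
  have : 0 <= E ^+ 3 by rewrite exprn_ge0 ?ltW.
  by rewrite !exprS expr0; nra.
have e1 : expR a * expR (- ((1 - eps ^+ 2) * x)) <= 1.
  by rewrite -expRD expR_le1 subr_le0.
(* The singularity at the ends of the interval is absorbed by [x], because [SE] gives
   [(a * eps) ^+ 2 <= S * (z * (1 - z))]. The resulting [x ^+ 3] cancels the [x ^- 3] that comes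
   from the Bessel bound and the factor [x^-1]. *)
have yx : (z * (1 - z)) `^ (- (3 / 2)) <= (x / (a * eps)) ^+ 3.
  have sy : Num.sqrt (z * (1 - z)) ^+ 2 = z * (1 - z).
    by rewrite sqr_sqrtr// ltW.
  have sy0 : 0 < Num.sqrt (z * (1 - z)) by rewrite sqrtr_gt0.
  have -> : (z * (1 - z)) `^ (- (3 / 2)) = (Num.sqrt (z * (1 - z)))^-1 ^+ 3.
    rewrite powRN (_ : 3 / 2 = 2^-1 * 3%:R); last by rewrite mulrC.
    by rewrite powRrM powR12_sqrt ?(ltW y0)// powR_mulrn ?(ltW sy0)// exprVn.
  rewrite lerXn2r ?nnegrE ?invr_ge0 ?(ltW sy0)//.
    by rewrite divr_ge0 ?(ltW x0)// mulr_ge0 ?ltW.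
  rewrite -[leRHS]invf_div lef_pV2 ?posrE ?divr_gt0 ?mulr_gt0//.
  rewrite ler_pdivrMr// -(@ler_pXn2r _ 2)// ?nnegrE ?mulr_ge0 ?(ltW a0)
    ?(ltW e0) ?(ltW sy0) ?(ltW x0)//.
  rewrite exprMn [leRHS]exprMn sy xS [leRHS]mulrC SE ler_wpM2l ?(ltW a20)//.
  by nra.
have pq : p * (1 - p) <= 1 by nra.
have pq0 : 0 <= p * (1 - p) by nra.
have pi0 := pi_gt0 R.
set E1 := expR a in e1 *; set E2 := expR (- _) in e1 *.
set Y := _ `^ _ in yx *.
have Y0 : 0 <= Y by exact: powR_ge0.
have E0 : 0 <= E1 * E2 by rewrite mulr_ge0 ?expR_ge0.
have -> : E1 * (a * p * (a * (1 - p))) *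
    (2 * pi / (eps ^+ 2 * x) ^+ 2 * E2) * x^-1 * Y =
    a ^+ 2 * (2 * pi) / (eps ^+ 4 * x ^+ 3) * ((p * (1 - p)) * (E1 * E2) * Y).
  by field; rewrite !lt0r_neq0.
have -> : 2 * pi / (eps ^+ 7 * a) =
    a ^+ 2 * (2 * pi) / (eps ^+ 4 * x ^+ 3) * (1 * 1 * (x / (a * eps)) ^+ 3).
  by field; rewrite !lt0r_neq0.
rewrite ler_wpM2l//; last by rewrite !ler_pM ?(mulr_ge0 pq0).
by rewrite ltW// divr_gt0// mulr_gt0 ?exprn_gt0// mulr_gt0.
Qed.

(** A power of zero with nonzero exponent is zero by convention, even for a negative exponent. The
    density therefore vanishes at the ends of the simplex, and only interior points require an
    estimate. *)
Lemma powR_mul_eq0_boundary (z0 z1 r : R) : r != 0 -> z1 = 1 - z0 ->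
  ~ (0 < z0 < 1) -> 0 <= z0 -> 0 <= z1 -> z0 `^ r * z1 `^ r = 0.
Proof.
move=> r0 -> z01 z0ge z1ge; have [z00|z0n] := eqVneq z0 0.
  by rewrite z00 powR0// mul0r.
have [z10|z1n] := eqVneq (1 - z0) 0; first by rewrite z10 powR0// mulr0.
by case: z01; rewrite !lt_def z0n z0ge -subr_eq0 z1n -subr_ge0.
Qed.

(** The indicator makes the constant bound integrable over the whole line. *)
Lemma NIG2_density_le (a p eps : R) (gamma z : 'I_2 -> R) :
  0 < a -> 0 < p < 1 -> gamma ord0 = a * p -> gamma ord_max = a * (1 - p) ->
  z ord_max = 1 - z ord0 -> 0 < eps <= 1 / 2 -> eps <= `|z ord0 - p| ->
  NIG_density gamma z <= 2 / (eps ^+ 7 * a) * \1_`[0, 1] (z ord0).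
Proof.
move=> a0 p01 g0 g1 z1 e01 ez.
have l01 : lift ord0 ord0 = ord_max :> 'I_2 by exact/val_inj.
have /andP[e0 e2] := e01.
have c0 : 0 <= 2 / (eps ^+ 7 * a).
  by rewrite divr_ge0// mulr_ge0 ?exprn_ge0// ltW.
rewrite /NIG_density !big_ord_recl !big_ord0 !l01 !addr0 !mulr1 g0 g1 z1.
have [zin|zout] := boolP (z \in @std_simplex R 2); last first.
  rewrite [X in _ * X](_ : _ = 0) ?mulr0; last by rewrite indicE (negbTE zout).
  by rewrite mulr_ge0// indicE.
have [zge _] : std_simplex z by rewrite inE in zin.
have z0ge := zge ord0; have z1ge := zge ord_max.
rewrite [X in _ * X](_ : _ = 1) ?mulr1; last by rewrite indicE zin.
have [z01|z01] := boolP (0 < z ord0 < 1); last first.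
  rewrite (powR_mul_eq0_boundary _ _ _ _ erefl) ?mulr0//.
  - by rewrite mulr_ge0// indicE.
  - exact/negP.
  - by rewrite -z1.
rewrite indicE mem_set ?mulr1/=; last first.
  by rewrite in_itv/= z0ge/= -subr_ge0 -z1.
set S := (_ / z ord0 + _).
have := NIG2_density_core_le a p eps (z ord0) a0 p01 e01 ez z01.
rewrite -/S; cbv zeta; set x := Num.sqrt S => core.
have S0 : 0 < S.
  case/andP: p01 z01 => p0 p1 /andP[z0 z11].
  by rewrite /S addr_gt0 ?divr_gt0 ?exprn_gt0 ?mulr_gt0 ?subr_gt0.
have x0 : 0 < x by rewrite sqrtr_gt0.
have K := @besselK_le R (eps ^+ 2) x.
have pi0 := pi_gt0 R.
have -> : a * p + a * (1 - p) = a by ring.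
have -> : 2 `^ (2 / 2 - 1) * pi `^ (2 / 2) = pi :> R.
  by rewrite divff ?pnatr_eq0// subrr powRr0 mul1r powRr1// ltW.
have -> : S `^ (- (2 / 4)) = x^-1.
  by rewrite powRN (_ : 2 / 4 = 2^-1) ?powR12_sqrt ?(ltW S0)//; field.
have z1ge' : 0 <= 1 - z ord0 by rewrite -z1.
rewrite -powRM//.
move: (pi : R) pi0 core K => q q0 core K.
(* For two cells the normalising constant is [pi], here [q]; dividing the core bound by it leaves
   the constant 2. *)
have -> : 2 / (eps ^+ 7 * a) = 2 * q / (eps ^+ 7 * a) / q.
  by field; rewrite !lt0r_neq0.
rewrite ler_pdivlMr//; apply: le_trans core.
rewrite [leLHS](_ : _ = expR a * (a * p * (a * (1 - p))) *
    besselK (- (2 / 2)) x * x^-1 * (z ord0 * (1 - z ord0)) `^ (- (3 / 2)));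
  last by field; rewrite !lt0r_neq0.
case/andP: p01 => p0 p1.
rewrite ler_wpM2r ?powR_ge0// ler_wpM2r ?invr_ge0 ?(ltW x0)// ler_wpM2l//.
  by rewrite mulr_ge0 ?expR_ge0// !mulr_ge0 ?subr_ge0 ?ltW.
by apply: K => //; nra.
Qed.

End density.

(** * Tail probabilities of a two-cell N-IG vector *)

Section tail.
Variable R : realType.

(** [lebesgue_tuple 1] is the image of Lebesgue measure times the Dirac mass at the empty tuple,
    which contributes a factor 1. *)
Lemma lebesgue_tuple1_itv (a b : R) : a <= b ->
  lebesgue_tuple 1 [set t : 1.-tuple (measurableTypeR R) |
    tnth t ord0 \in `[a, b]] = (b - a)%:E.
Proof.
move=> ab; rewrite /= /lebesgue_tcons /pushforward.
rewrite (_ : _ @^-1` _ = `[a, b]%classic `*` setT); last first.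
  by apply/seteqP; split => -[x t] //= [].
rewrite product_measure1E//= diracT mule1 lebesgue_measure_itv/= lte_fin.
case: ltgtP ab => // -> _.
by rewrite subrr.
Qed.

Lemma NIG_density_ge0 m (gamma z : 'I_m -> R) :
  (forall i, 0 < gamma i) -> 0 <= NIG_density gamma z.
Proof.
move=> g0; have K0 nu x : 0 <= besselK nu x :> R.
  rewrite mulr_ge0// fine_ge0// integral_ge0// => t _.
  by rewrite lee_fin mulr_ge0 ?powR_ge0 ?expR_ge0.
have prodg0 : 0 <= \prod_(i < m) gamma i.
  by rewrite prodr_ge0// => i _; rewrite ltW.
have prodz0 : 0 <= \prod_(i < m) z i `^ (- (3 / 2)).
  by rewrite prodr_ge0// => i _; rewrite powR_ge0.
rewrite /NIG_density; apply: mulr_ge0; last by rewrite indicE.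
apply: mulr_ge0 => //; apply: mulr_ge0; last exact: powR_ge0.
apply: mulr_ge0; last exact: K0.
by rewrite divr_ge0// mulr_ge0 ?powR_ge0 ?expR_ge0.
Qed.

(** Two cells leave one free coordinate, confined to an interval of length 1, so the bound on the
    density is also a bound on the probability. *)
Lemma NIG2_tail_le d (Omega : measurableType d) (Pr : probability Omega R)
    (a p eps : R) (gamma : 'I_2 -> R)
    (Z : 'I_2 -> Omega -> measurableTypeR R) :
  0 < a -> 0 < p < 1 -> gamma ord0 = a * p -> gamma ord_max = a * (1 - p) ->
  has_NIG_law Pr gamma Z -> 0 < eps <= 1 / 2 ->
  (Pr [set w | (eps <= `|Z ord0 w - p|)%R] <= (2 / (eps ^+ 7 * a))%:E)%E.
Proof.
move=> a0 p01 g0 g1 [_ gpos _ _ law] e01.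
have /andP[e0 _] := e01.
set c := 2 / _.
have c0 : 0 <= c by rewrite /c divr_ge0// mulr_ge0 ?exprn_ge0// ltW.
have l0 : lift ord_max ord0 = ord0 :> 'I_2 by exact/val_inj.
have mfst : measurable_fun setT
    (fun t : 1.-tuple (measurableTypeR R) => tnth t ord0 : measurableTypeR R).
  exact: measurable_tnth.
pose B := [set t : 1.-tuple (measurableTypeR R) | eps <= `|tnth t ord0 - p|].
have mB : measurable B.
  have -> : B = setT `&` (fun t : 1.-tuple (measurableTypeR R) =>
      `|tnth t ord0 - p| : measurableTypeR R) @^-1` `[eps, +oo[%classic.
    by rewrite setTI; apply/seteqP; split => t /=; rewrite in_itv/= andbT.
  suff mg : measurable_fun setT (fun t : 1.-tuple (measurableTypeR R) =>
      `|tnth t ord0 - p| : measurableTypeR R) by exact: mg.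
  by apply: measurableT_comp => //; exact: measurable_funB.
have := law B mB; rewrite (_ : [set w | B _] =
    [set w | (eps <= `|Z ord0 w - p|)%R]); last first.
  by apply/seteqP; split => w; rewrite /B/= tnth_mktuple l0.
move=> ->.
have -> : c%:E = (\int[lebesgue_tuple 1]_(t in
    [set t : 1.-tuple (measurableTypeR R) | tnth t ord0 \in `[0%R, 1%R]])
    (cst c%:E t))%E.
  rewrite integral_cst.
    by rewrite [X in (_ * X)%E](lebesgue_tuple1_itv 0 1 ler01) subr0 mule1.
  by have := mfst measurableT _ (measurable_itv `[0, 1]); rewrite setTI.
rewrite [leRHS]integral_mkcond; apply: ge0_le_integral_nonmeasurable.
- by move=> t; rewrite lee_fin NIG_density_ge0.
- by move=> t; rewrite patchE; case: ifP => // _; rewrite lee_fin.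
move=> t Bt; split => //.
have s0 : simplex_point t ord0 = tnth t ord0.
  by rewrite /simplex_point -l0 liftK.
have s1 : simplex_point t ord_max = 1 - tnth t ord0.
  by rewrite /simplex_point unlift_none big_ord_recl big_ord0 addr0.
have : NIG_density gamma (simplex_point t) <= c * \1_`[0, 1] (tnth t ord0).
  by rewrite -s0; apply: (@NIG2_density_le _ a p eps); rewrite // s0.
rewrite patchE indicE mem_setE.
have [tin|tout] := boolP (tnth t ord0 \in `[0, 1]).
  by rewrite mulr1 mem_set// lee_fin.
by rewrite mulr0 memNset ?lee_fin//; exact/negP.
Qed.

End tail.

(** * Borel-Cantelli, and almost sure convergence on a fixed measurable set *)

Section almost_sure_convergence.
Variable R : realType.

Lemma measurable_le_dist d (T : measurableType d) (X : T -> R) (l eps : R) :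
  measurable_fun setT X -> measurable [set w | eps <= `|X w - l|].
Proof.
move=> mX.
have -> : [set w | eps <= `|X w - l|] =
    setT `&` (fun w => `|X w - l|) @^-1` `[eps, +oo[%classic.
  by rewrite setTI; apply/seteqP; split => t /=; rewrite in_itv/= andbT.
suff mg : measurable_fun setT (fun w => `|X w - l|) by exact: mg.
by apply: measurableT_comp => //; exact: measurable_funB.
Qed.

(** Borel-Cantelli is applied at the thresholds [k.+1%:R^-1], so that only countably many null sets
    are discarded. *)
Lemma ae_cvg_summable_tail d (T : measurableType d)
    (mu : {measure set T -> \bar R}) (X : nat -> T -> R) (l : R) :
  (forall n, measurable_fun setT (X n)) ->
  (forall eps, 0 < eps ->
    (\sum_(n <oo) mu [set w | (eps <= `|X n w - l|)%R] < +oo)%E) ->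
  {ae mu, forall w, X n w @[n --> \oo] --> l}.
Proof.
move=> mX sX.
pose F eps n := [set w | eps <= `|X n w - l|].
have mF eps n : measurable (F eps n) by exact: measurable_le_dist.
have aeF k : {ae mu, forall w, ~ lim_sup_set (F k.+1%:R^-1) w}.
  apply: (@negligibleS _ _ _ mu (lim_sup_set (F k.+1%:R^-1))).
    by move=> w /= /contrapT.
  apply/negligibleP.
    by apply: bigcap_measurable => // n _; exact: bigcup_measurable.
  by apply: lim_sup_set_cvg0 => //; apply: sX; rewrite invr_gt0.
apply: filterS (ae_foralln aeF) => w Fw.
apply/cvgrPdist_lt => e e0.
have [k ke] : exists k, k.+1%:R^-1 < e.
  have [k _ /(_ k (leqnn _))] := near_infty_natSinv_lt (PosNum e0).
  by exists k.
have /existsNP[N /not_implyP[_ NF]] := Fw k.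
near=> n; rewrite distrC ltNge; apply/negP => en.
apply: NF; exists n; first by near: n; exact: nbhs_infty_ge.
by rewrite /F/= (le_trans (ltW ke)).
Unshelve. all: by end_near. Qed.

Lemma nneseries_inv_sqr_lty (K : R) : 0 <= K ->
  (\sum_(n <oo) (K / n.+1%:R ^+ 2)%:E < +oo)%E.
Proof.
move=> K0; apply: (@le_lt_trans _ _ (K * 2)%:E); last exact: ltry.
apply: lime_le.
  by apply: is_cvg_nneseries => n _ _; rewrite lee_fin divr_ge0// sqr_ge0.
apply: nearW => n; rewrite sumEFin lee_fin -mulr_sumr ler_wpM2l//.
case: n => [|n]; first by rewrite big_geq.
(* The correction [- n.+1%:R^-1] makes the induction go through: the slack at each step is exactly
   [(x * (x + 1) ^+ 2)^-1]. *)
suff : \sum_(0 <= i < n.+1) (i.+1%:R ^+ 2)^-1 <= 2 - n.+1%:R^-1 :> R.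
  by move/le_trans; apply; rewrite gerBl invr_ge0.
elim: n => [|n IHn]; first by rewrite big_nat1 expr1n !invr1; lra.
rewrite big_nat_recr//=; apply: le_trans (lerD IHn (lexx _)) _.
have n0 : 0 < n.+1%:R :> R by [].
rewrite -[n.+2]addn1 natrD; set x := n.+1%:R in n0 *.
rewrite -subr_ge0.
have -> : 2 - (x + 1)^-1 - (2 - x^-1 + ((x + 1) ^+ 2)^-1) =
    (x * (x + 1) ^+ 2)^-1.
  by field; rewrite !lt0r_neq0// addr_gt0.
by rewrite invr_ge0 mulr_ge0 ?sqr_ge0// ltW.
Qed.

Lemma pker_setC d (Omega : measurableType d) dT (T : measurableType dT)
    (P : R.-pker Omega ~> T) (w : Omega) (A : set T) :
  measurable A -> P w (~` A) = (1 - P w A)%E.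
Proof.
move=> mA; rewrite -(prob_kernel (s := P) w) -(setvU A) measureU ?setICl//.
  by rewrite addeK// finite_kernel_measure.
exact: measurableC.
Qed.

Lemma measurable_fine_pker d (Omega : measurableType d) dT
    (T : measurableType dT) (P : R.-pker Omega ~> T) (A : set T) :
  measurable A -> measurable_fun setT (fun w => fine (P w A)).
Proof.
by move=> mA; apply: measurableT_comp => //; exact: measurable_kernel.
Qed.

(** The partition into [A] and its complement reduces the claim to two cells. If [H A] is 0 or 1, no
    N-IG law is available, but the clause on null cells forces [P w A] to equal [H A] almost
    surely. *)
Lemma NIGP_tail_le d (Omega : measurableType d) (Pr : probability Omega R)
    dT (T : measurableType dT) (a eps : R) (H : probability T R)
    (P : R.-pker Omega ~> T) (A : set T) :
  is_NIGP Pr a H P -> measurable A -> 0 < eps <= 1 / 2 ->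
  (Pr [set w | (eps <= `|fine (P w A) - fine (H A)|)%R] <=
    (2 / (eps ^+ 7 * a))%:E)%E.
Proof.
move=> [a0 hP] mA e01; have /andP[e0 e2] := e01.
pose C (i : 'I_2) := if i == ord0 then A else ~` A.
have mC i : measurable (C i).
  by rewrite /C; case: ifP => // _; exact: measurableC.
have C1 : C ord_max = ~` A by [].
have tC : trivIset setT C.
  apply/trivIsetP => -[[|[|i]] hi] -[[|[|j]] hj] _ _ //= _.
    exact: setICr.
  exact: setICl.
have UC : \bigcup_i C i = setT.
  apply/seteqP; split => // x _; have [Ax|nAx] := pselect (A x).
    by exists ord0.
  by exists ord_max.
have [null law] := hP 2%N C mC tC UC.
have HC : (H (~` A) = 1 - H A)%E by exact: probability_setC.
have finH : H A \is a fin_num by exact: fin_num_measure.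
have c0 : 0 <= 2 / (eps ^+ 7 * a).
  by rewrite divr_ge0// mulr_ge0 ?exprn_ge0// ltW.
have degenerate : {ae Pr, forall w, fine (P w A) = fine (H A)} ->
    (Pr [set w | (eps <= `|fine (P w A) - fine (H A)|)%R] <=
      (2 / (eps ^+ 7 * a))%:E)%E.
  move=> PH; rewrite (_ : Pr _ = 0%E) ?lee_fin//; apply: measure_negligible.
    by apply: measurable_le_dist; exact: measurable_fine_pker.
  apply: negligibleS PH => w /= ew PwA; move: ew.
  by rewrite PwA subrr normr0 leNgt e0.
have [H0|H0] := eqVneq (H A) 0%E.
  apply: degenerate; apply: filterS (null ord0 H0) => w.
  by rewrite /C eqxx H0 => ->.
have [H1|H1] := eqVneq (H A) 1%E.
  have HC0 : H (C ord_max) = 0%E by rewrite C1 HC H1 subee.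
  apply: degenerate; apply: filterS (null ord_max HC0) => w.
  rewrite C1 pker_setC// H1 => /eqP.
  have := @finite_kernel_measure _ _ _ _ _ P w A mA.
  by case: (P w A) => //= r _; rewrite -EFinB eqe subr_eq0 => /eqP <-.
have HA : H A = (fine (H A))%:E by rewrite fineK.
have p01 : 0 < fine (H A) < 1.
  rewrite -!lte_fin -HA !lt_neqAle H1 eq_sym H0 measure_ge0/=.
  exact: probability_le1.
have Hmax : fine (H (C ord_max)) = 1 - fine (H A) by rewrite C1 HC HA.
(* Both cells have positive mass, so the identity enumerates them. *)
have /law : {homo (id : 'I_2 -> 'I_2) : i j / (i < j)%N} by [].
move=> /(_ isT) ls.
apply: (@NIG2_tail_le R d Omega Pr a _ _ (fun j => a * fine (H (C j)))
  (fun j w => fine (P w (C j)))) => //.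
- by rewrite Hmax.
- apply: ls => i; split => [_|_]; first by exists i.
  case/andP: p01 => p0 p1.
  rewrite /C; case: ifPn => _; first by rewrite HA lte_fin.
  by rewrite HC HA -EFinB lte_fin subr_gt0.
Qed.

Lemma NIGP_ae_cvg d (Omega : measurableType d) (Pr : probability Omega R)
    dT (T : measurableType dT) (c : R) (H : probability T R)
    (P : nat -> R.-pker Omega ~> T) (A : set T) : 0 < c ->
  (forall n : nat, (0 < n)%N -> is_NIGP Pr (n%:R ^+ 2 * c) H (P n)) ->
  measurable A ->
  {ae Pr, forall w, fine (P n w A) @[n --> \oo] --> fine (H A)}.
Proof.
move=> c0 hP mA.
(* The shift avoids the index 0, about which nothing is assumed. *)
suff : {ae Pr, forall w, fine (P n.+1 w A) @[n --> \oo] --> fine (H A)}.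
  by apply: filterS => w; rewrite (cvg_shiftS (fun n => fine (P n w A))).
apply: (@ae_cvg_summable_tail _ _ Pr (fun n w => fine (P n.+1 w A))).
  by move=> n; exact: measurable_fine_pker.
(* The tail bound requires [eps <= 1 / 2]; lowering the threshold only enlarges the event. *)
move=> eps0 eps00; pose eps := Num.min eps0 (1 / 2).
have e01 : 0 < eps <= 1 / 2.
  by rewrite /eps lt_min eps00 divr_gt0// ge_min lexx orbT.
have /andP[e0 _] := e01.
pose K := 2 / (eps ^+ 7 * c).
have K0 : 0 <= K by rewrite /K divr_ge0// mulr_ge0 ?exprn_ge0// ltW.
apply: le_lt_trans (nneseries_inv_sqr_lty K K0).
apply: lee_nneseries => [//|n _].
apply: (@le_trans _ _
    (Pr [set w | (eps <= `|fine (P n.+1 w A) - fine (H A)|)%R])).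
  rewrite le_measure ?inE//.
  - by apply: measurable_le_dist; exact: measurable_fine_pker.
  - by apply: measurable_le_dist; exact: measurable_fine_pker.
  - by move=> w /=; apply: le_trans; rewrite ge_min lexx.
rewrite (_ : K / _ = 2 / (eps ^+ 7 * (n.+1%:R ^+ 2 * c))).
  by apply: NIGP_tail_le => //; exact: hP.
by rewrite /K; field; rewrite !lt0r_neq0.
Qed.

End almost_sure_convergence.

(** * Quantiles, and uniform convergence from convergence at quantiles *)

Section glivenko_cantelli.
Variable R : realType.
Notation RR := (measurableTypeR R).

(** Under [H] the identity is a random variable of law [H], so its [cdf] is the distribution
    function of [H]. *)
Let idR : RR -> R := idfun.

HB.instance Definition _ :=
  @isMeasurableFun.Build _ _ _ _ idR (@measurable_id _ RR setT).

(** The witness is the infimum of the points where the distribution function reaches [u]. Continuity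
    from below bounds the mass strictly to its left, and right continuity gives the other
    inequality; an atom may separate the two. *)
Lemma probability_quantile (H : probability RR R) (u : R) : 0 < u < 1 ->
  exists y : R, (H `]-oo, y[ <= u%:E <= H `]-oo, y])%classic%E.
Proof.
move=> /andP[u0 u1]; pose F : R -> \bar R := cdf (idR : {RV H >-> R}).
have FE x : F x = H `]-oo, x]%classic by [].
have ndF x y : x <= y -> (F x <= F y)%E by move=> xy; exact: cdf_nondecreasing.
pose S := [set x | (u%:E <= F x)%E].
have S0 : S !=set0.
  have : \forall x \near +oo%R, (u%:E < F x)%E.
    apply: (@cvg_cdfy1 _ _ _ _ (idR : {RV H >-> R}) [set z | u%:E < z]%E).
    by apply: open_ereal_gt'; rewrite lte_fin.
  by move=> /filter_ex[x ux]; exists x; exact: ltW.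
have lbS : has_lbound S.
  have : \forall x \near -oo%R, (F x < u%:E)%E.
    apply: (@cvg_cdfNy0 _ _ _ _ (idR : {RV H >-> R}) [set z | z < u%:E]%E).
    by apply: open_ereal_lt'; rewrite lte_fin.
  move=> /filter_ex[x xu]; exists x => z uz.
  by rewrite leNgt; apply/negP => /ltW/ndF/(le_trans uz); rewrite leNgt xu.
have infS : has_inf S by [].
exists (inf S); apply/andP; split.
  have -> : `]-oo, inf S[%classic =
      \bigcup_n `]-oo, (inf S - n.+1%:R^-1)]%classic.
    apply/seteqP; split => [x /=|x [n _] /=]; rewrite !in_itv/=.
      move=> xS; have e0 : 0 < inf S - x by rewrite subr_gt0.
      have [k _ /(_ k (leqnn _)) /= ke] := near_infty_natSinv_lt (PosNum e0).
      by exists k => //=; rewrite in_itv/= lerBrDr -lerBrDl ltW.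
    by move=> /le_lt_trans; apply; rewrite gtrBl invr_gt0.
  have : H \o (fun n => `]-oo, (inf S - n.+1%:R^-1)]%classic) @ \oo -->
      H (\bigcup_n `]-oo, (inf S - n.+1%:R^-1)]%classic).
    apply: nondecreasing_cvg_mu => //; first exact: bigcup_measurable.
    move=> m n mn; apply/subsetPset/subitvPr.
    by rewrite bnd_simp lerB// lef_pV2 ?posrE// ler_nat.
  apply: cvge_le; apply: nearW => n /=; rewrite leNgt; apply/negP => /ltW un.
  have := ge_inf lbS un; rewrite leNgt => /negP; apply.
  by rewrite gtrBl invr_gt0.
rewrite -FE leNgt; apply/negP => Fu.
have : \forall x \near (inf S)^'+, (F x < u%:E)%E.
  apply: (@cdf_right_continuous _ _ _ _ (idR : {RV H >-> R}) _
    [set z | z < u%:E]%E).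
  exact: open_ereal_lt'.
have : \forall x \near (inf S)^'+, inf S < x by exact: nbhs_right_gt.
move=> /filterI/[apply] /filter_ex[x [Sx Fxu]].
have xS : 0 < x - inf S by rewrite subr_gt0.
have [z uz] := inf_adherent xS infS.
rewrite addrC subrK => /ltW/ndF/(le_trans uz).
by rewrite leNgt Fxu.
Qed.

(* [G] and [Gn] stand for the left limits of the distribution functions. *)
Lemma uniform_cvg_at_quantiles (F G : R -> R) (Fn Gn : nat -> R -> R)
    (y : R -> R) :
  (forall x, 0 <= F x <= 1) -> (forall n x, 0 <= Fn n x <= 1) ->
  {homo F : x z / x <= z} -> (forall n, {homo Fn n : x z / x <= z}) ->
  (forall x z, x < z -> F x <= G z) ->
  (forall n x z, x < z -> Fn n x <= Gn n z) ->
  (forall u, 0 < u < 1 -> G (y u) <= u <= F (y u)) ->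
  (forall N j : nat, Fn n (y (j%:R / N%:R)) @[n --> \oo] -->
    F (y (j%:R / N%:R))) ->
  (forall N j : nat, Gn n (y (j%:R / N%:R)) @[n --> \oo] -->
    G (y (j%:R / N%:R))) ->
  forall e, 0 < e -> \forall n \near \oo, forall x, `|Fn n x - F x| <= e.
Proof.
move=> F01 Fn01 ndF ndFn FG FnGn yq cvgF cvgG e e0.
have e3 : 0 < e / 3 by rewrite divr_gt0.
have [N Ne] : exists N, N.+1%:R^-1 < e / 3.
  have [N _ /(_ N (leqnn _))] := near_infty_natSinv_lt (PosNum e3).
  by exists N.
have N0 : 0 < N.+1%:R :> R by [].
have nearF : \forall n \near \oo, forall j : 'I_N.+1,
    `|F (y (j%:R / N.+1%:R)) - Fn n (y (j%:R / N.+1%:R))| < e / 3.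
  apply: filter_forall => j.
  by have /cvgrPdist_lt/(_ _ e3) := cvgF N.+1 j.
have nearG : \forall n \near \oo, forall j : 'I_N.+1,
    `|G (y (j%:R / N.+1%:R)) - Gn n (y (j%:R / N.+1%:R))| < e / 3.
  apply: filter_forall => j.
  by have /cvgrPdist_lt/(_ _ e3) := cvgG N.+1 j.
near=> n.
have nF : forall j : 'I_N.+1,
    `|F (y (j%:R / N.+1%:R)) - Fn n (y (j%:R / N.+1%:R))| < e / 3.
  by near: n; exact: nearF.
have nG : forall j : 'I_N.+1,
    `|G (y (j%:R / N.+1%:R)) - Gn n (y (j%:R / N.+1%:R))| < e / 3.
  by near: n; exact: nearG.
move=> x; have /andP[Fx0 Fx1] := F01 x; have /andP[Fnx0 Fnx1] := Fn01 n x.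
have NF0 : 0 <= N.+1%:R * F x by rewrite mulr_ge0.
(* [j] locates [F x] in the grid of mesh [N.+1%:R^-1]. *)
have /andP := Num.Theory.truncn_itv NF0; set j := Num.truncn _ => -[jF Fj].
have {}jF : j%:R / N.+1%:R <= F x by rewrite ler_pdivrMr// mulrC.
have {}Fj : F x < j.+1%:R / N.+1%:R by rewrite ltr_pdivlMr// mulrC.
have jS : j.+1%:R / N.+1%:R = j%:R / N.+1%:R + N.+1%:R^-1 :> R.
  by rewrite -addn1 natrD mulrDl mul1r.
rewrite ler_norml; apply/andP; split.
  (* The lower bound uses the quantile one grid step below the cell of [F x]: its order is strictly
     less than [F x], which forces it to lie at or left of [x]. In the two lowest cells [F x] is
     already below [e]. *)
  case: j jF Fj jS => [|[|j]] jF Fj jS.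
  - by move: Fj; rewrite jS mulr0n mul0r add0r; move: Ne; set M := _^-1; lra.
  - by move: Fj; rewrite jS mulr1n mul1r; move: Ne; set M := _^-1; lra.
  have jN : (j.+2 <= N.+1)%N.
    have := le_trans jF Fx1; rewrite ler_pdivrMr// mul1r ler_nat.
    by [].
  have u01 : 0 < (j.+1%:R / N.+1%:R : R) < 1.
    by rewrite divr_gt0//= ltr_pdivrMr// mul1r ltr_nat.
  have jS' : j.+2%:R / N.+1%:R = j.+1%:R / N.+1%:R + N.+1%:R^-1 :> R.
    by rewrite -[j.+2]addn1 natrD mulrDl mul1r.
  have /andP[Gu uF] := yq _ u01.
  have yx : y (j.+1%:R / N.+1%:R) <= x.
    rewrite leNgt; apply/negP => /FG; move: jF Gu; rewrite jS'.
    have := N0; rewrite -invr_gt0.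
    by move: (j.+1%:R / N.+1%:R : R) (N.+1%:R^-1 : R) => U M; lra.
  have := nF (Ordinal jN); rewrite /= ltr_norml => /andP[_].
  have := ndFn n _ _ yx; move: Fj uF Ne; rewrite jS jS'.
  by move: (j.+1%:R / N.+1%:R : R) (N.+1%:R^-1 : R) => U M; lra.
(* The upper bound uses the next quantile and its left limit [G], which stays below the order even
   if there is an atom at the quantile. In the top cells [Fn n x <= 1] suffices. *)
have [jN|jN] := leqP N.+1 j.+1.
  have : 1 <= j.+1%:R / N.+1%:R :> R by rewrite ler_pdivlMr// mul1r ler_nat.
  move: jF Ne; rewrite jS.
  by move: (j%:R / N.+1%:R : R) (N.+1%:R^-1 : R) => U M; lra.
have u01 : 0 < (j.+1%:R / N.+1%:R : R) < 1.
  by rewrite divr_gt0//= ltr_pdivrMr// mul1r ltr_nat.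
have /andP[Gu uF] := yq _ u01.
have xy : x < y (j.+1%:R / N.+1%:R).
  rewrite ltNge; apply/negP => /ndF; move: Fj uF.
  by move: (j.+1%:R / N.+1%:R : R) => U; lra.
have := nG (Ordinal jN); rewrite /= ltr_norml => /andP[+ _].
have := FnGn n _ _ xy; move: Gu jF Ne; rewrite jS.
by move: (j%:R / N.+1%:R : R) (N.+1%:R^-1 : R) => U M; lra.
Unshelve. all: by end_near. Qed.

End glivenko_cantelli.

Theorem theorem3 (R : realType) (d : measure_display)
    (Omega : measurableType d) (Pr : probability Omega R)
    (H : probability (measurableTypeR R) R) (c : R) (hc : 0 < c)
    (P : nat -> R.-pker Omega ~> measurableTypeR R)
    (hP : forall n : nat, (0 < n)%N -> is_NIGP Pr (n%:R ^+ 2 * c) H (P n)) :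
  {ae Pr, forall w : Omega,
    ereal_sup [set `| P n w `]-oo, x]%classic - H `]-oo, x]%classic |%E | x in [set: R]]
      @[n --> \oo] --> 0%E}.
Proof.
have [y yq] : {y : R -> R & forall u : R, 0 < u < 1 ->
    (H `]-oo, y u[ <= u%:E <= H `]-oo, y u])%classic%E}.
  apply: (@choice _ _ (fun u y => 0 < u < 1 ->
    (H `]-oo, y[ <= u%:E <= H `]-oo, y])%classic%E)) => u.
  have [u01|/negP u01] := boolP (0 < u < 1); last by exists 0.
  by have [y yq] := probability_quantile R H u u01; exists y.
pose F x := fine (H `]-oo, x]%classic).
pose G x := fine (H `]-oo, x[%classic).
pose Fn w n x := fine (P n w `]-oo, x]%classic).
pose Gn w n x := fine (P n w `]-oo, x[%classic).
(* The null sets for the countably many pairs [N], [j] are merged. Pairs whose quotient lies outside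
   the open unit interval, including [N = 0], are harmless: convergence holds at any point, whatever
   value [y] takes there. *)
have aeF : {ae Pr, forall w, forall N j : nat,
    Fn w n (y (j%:R / N%:R)) @[n --> \oo] --> F (y (j%:R / N%:R))}.
  apply: ae_foralln => N; apply: ae_foralln => j.
  exact: (NIGP_ae_cvg _ _ _ Pr _ _ c).
have aeG : {ae Pr, forall w, forall N j : nat,
    Gn w n (y (j%:R / N%:R)) @[n --> \oo] --> G (y (j%:R / N%:R))}.
  apply: ae_foralln => N; apply: ae_foralln => j.
  exact: (NIGP_ae_cvg _ _ _ Pr _ _ c).
have finP n w A : measurable A -> P n w A \is a fin_num.
  exact: finite_kernel_measure.
have finH A : measurable A -> H A \is a fin_num by exact: fin_num_measure.
have leH A B : measurable A -> measurable B -> A `<=` B ->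
    fine (H A) <= fine (H B).
  by move=> mA mB AB; rewrite fine_le ?finH// le_measure ?inE.
have leP n w A B : measurable A -> measurable B -> A `<=` B ->
    fine (P n w A) <= fine (P n w B).
  by move=> mA mB AB; rewrite fine_le ?finP// le_measure ?inE.
have itv_le (x z : R) : x <= z -> `]-oo, x] `<=` `]-oo, z].
  by move=> xz; exact: subitvPr.
have itv_lt (x z : R) : x < z -> `]-oo, x] `<=` `]-oo, z[.
  by move=> xz; exact: subitvPr.
apply: filterS2 aeF aeG => w cvgF cvgG.
have unif := @uniform_cvg_at_quantiles R F G (Fn w) (Gn w) y.
have {}unif e : 0 < e -> \forall n \near \oo, forall x, `|Fn w n x - F x| <= e.
  apply: unif => //.
  - move=> x; rewrite fine_ge0//=; have := leH `]-oo, x]%classic setT.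
    by rewrite probability_setT; exact.
  - move=> n x; rewrite fine_ge0//=; have := leP n w `]-oo, x]%classic setT.
    by rewrite prob_kernel; exact.
  - by move=> x z xz; apply: leH => //; exact: itv_le.
  - by move=> n x z xz; apply: leP => //; exact: itv_le.
  - by move=> x z xz; apply: leH => //; exact: itv_lt.
  - by move=> n x z xz; apply: leP => //; exact: itv_lt.
  - by move=> u /yq; rewrite -!lee_fin !fineK ?finH.
have distE n x : `|P n w `]-oo, x]%classic - H `]-oo, x]%classic|%E =
    (`|Fn w n x - F x|)%:E.
  have -> : P n w `]-oo, x]%classic = (Fn w n x)%:E by rewrite fineK ?finP.
  by have -> : H `]-oo, x]%classic = (F x)%:E by rewrite fineK ?finH.
pose s n := ereal_sup
  [set `|P n w `]-oo, x]%classic - H `]-oo, x]%classic|%E | x in [set: R]].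
have s_ge0 n : (0 <= s n)%E.
  apply: ereal_sup_ge.
  by exists `|Fn w n 0 - F 0|%:E; [exists 0|rewrite lee_fin].
have s_le e : 0 < e -> \forall n \near \oo, (s n <= e%:E)%E.
  move=> /unif; apply: filterS => n sup_le.
  by apply: ge_ereal_sup => _ [x _ <-]; rewrite distE lee_fin.
have s_fin n e : (s n <= e%:E)%E -> s n = (fine (s n))%:E.
  by move=> sne; rewrite fineK// ge0_fin_numE// (le_lt_trans sne)// ltry.
(* Convergence in the extended reals amounts to eventual finiteness of the supremum and convergence
   of its real value. *)
apply/fine_cvgP; split.
  by apply: filterS (s_le 1 ltr01) => n /s_fin; rewrite -/(s n) => ->.
apply/cvgrPdist_le => e e0; apply: filterS (s_le e e0) => n sne.
suff : fine (s n) <= e.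
  by rewrite sub0r normrN ger0_norm//; exact/fine_ge0/s_ge0.
by rewrite -lee_fin -(s_fin n e).
Qed.
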